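(* The static decision version of the tokenized multi-armed bandit problem (TMAB) reduces to the static decision version of the (generalized, $k$-ary) bandit tree search problem: every instance of static decision TMAB can be transformed into an instance of static decision tree search on a $k$-ary tree (for some $k$), such that the TMAB instance is a Yes instance if and only if the tree search instance is a Yes instance.
   Context: **Static decision TMAB.** An instance consists of a finite token set $\mathcal V$ containing a special token $\mathrm{EOS}$, a maximal length $L$, a utility function $u$ from finite token sequences over $\mathcal V$ to $\mathbb R_{\ge0}$, and a threshold $A\ge0$. A sequence is complete if its last token is $\mathrm{EOS}$. It is a Yes instance iff there is a complete sequence $\mathbf y$ of length at most $L$ with $u(\mathbf y)\ge A$. The utility $u$ is assumed monotone: (i) appending further $\mathrm{EOS}$ tokens to a sequence ending in $\mathrm{EOS}$ does not change $u$, and (ii) appending a non-$\mathrm{EOS}$ token to a sequence ending in $\mathrm{EOS}$ can only decrease $u$. **Static decision (generalized) bandit tree search.** An instance consists of a rooted $k$-ary tree of finite depth (each node has at most $k$ children), a utility function $v$ assigning a nonnegative real value $v(l)$ to every leaf $l$, and a threshold $A\ge0$. It is a Yes instance iff there is a leaf $l$ with $v(l)\ge A$. *)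

(* Defs.v *)
From HB Require Import structures.
From mathcomp Require Import all_boot all_order all_algebra.
From mathcomp Require Import reals.

Set Implicit Arguments.
Unset Strict Implicit.
Unset Printing Implicit Defensive.

Import Order.TTheory GRing.Theory Num.Theory.
Local Open Scope ring_scope.

(* The empty sequence is not complete; [last eos s == eos] would accept it. *)
Definition complete (V : eqType) (eos : V) (s : seq V) : bool :=
  if s is x :: s' then last x s' == eos else false.

Record tmab (R : realType) (V : finType) (eos : V) := Tmab {
  tmab_length : nat;
  tmab_utility : seq V -> R;
  tmab_threshold : R;
  tmab_utility_ge0 : forall s, 0 <= tmab_utility s;
  tmab_threshold_ge0 : 0 <= tmab_threshold;
  tmab_utility_eos : forall s n, complete eos s ->
    tmab_utility (s ++ nseq n eos) = tmab_utility s;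
  tmab_utility_non_eos : forall s c, complete eos s -> c != eos ->
    tmab_utility (rcons s c) <= tmab_utility s
}.

Definition tmab_yes (R : realType) (V : finType) (eos : V) (I : tmab R eos) :
    Prop :=
  exists s : seq V, [/\ complete eos s, (size s <= tmab_length I)%N
                      & tmab_threshold I <= tmab_utility I s].

(* A finite rooted tree is its root together with the list of the subtrees
   rooted at its children. *)
Inductive rtree : Type := Node of seq rtree.

Fixpoint kary (k : nat) (t : rtree) : bool :=
  let: Node ts := t in (size ts <= k)%N && all (kary k) ts.

(* A node is addressed by the child indices on the path from the root to it;
   [subtree t p] is [None] when [p] does not address a node of [t]. *)
Fixpoint subtree (t : rtree) (p : seq nat) : option rtree :=
  if p is i :: p' then
    let: Node ts := t in
    if onth ts i is Some t' then subtree t' p' else None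
  else Some t.

Definition is_leaf (t : rtree) (p : seq nat) : bool :=
  if subtree t p is Some (Node [::]) then true else false.

(* Only the values of [ts_value] at addresses of leaves are meaningful. *)
Record tree_search (R : realType) := TreeSearch {
  ts_arity : nat;
  ts_tree : rtree;
  ts_value : seq nat -> R;
  ts_threshold : R;
  ts_treeP : kary ts_arity ts_tree;
  ts_value_ge0 : forall l, is_leaf ts_tree l -> 0 <= ts_value l;
  ts_threshold_ge0 : 0 <= ts_threshold
}.

Definition tree_search_yes (R : realType) (J : tree_search R) : Prop :=
  exists2 l, is_leaf (ts_tree J) l & ts_threshold J <= ts_value J l.

(* A bare map preserving Yes and No always exists classically: send every Yes
   instance to one fixed Yes instance and every No instance to one fixed No
   instance.  A transformation should not solve the instance it transforms, so
   it may only use the utility as a black box: the arity, the tree and the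
   threshold do not depend on the utility, and the value of a leaf depends on
   it only through its value at one sequence [q], itself chosen independently
   of the utility. *)
Definition black_box (R : realType)
    (f : forall (V : finType) (eos : V), tmab R eos -> tree_search R) : Prop :=
  exists q : forall V : finType, V -> nat -> R -> seq nat -> seq V,
  forall (V : finType) (eos : V) (I I' : tmab R eos),
    tmab_length I = tmab_length I' -> tmab_threshold I = tmab_threshold I' ->
    [/\ ts_arity (f V eos I) = ts_arity (f V eos I'),
        ts_tree (f V eos I) = ts_tree (f V eos I'),
        ts_threshold (f V eos I) = ts_threshold (f V eos I')
      & forall l, is_leaf (ts_tree (f V eos I)) l ->
        let s := q V eos (tmab_length I) (tmab_threshold I) l in
        tmab_utility I s = tmab_utility I' s ->
        ts_value (f V eos I) l = ts_value (f V eos I') l].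

(* Main.v *)
(** Complete sequences of length exactly [L] are the words of length [L - 1]
    followed by EOS, i.e. the leaves of the full [#|V|]-ary tree of depth
    [L - 1]; the value of a leaf is the utility of its sequence.  By padding
    with EOS, which leaves the utility unchanged, complete sequences of length
    exactly [L] suffice.  When [L = 0] there is no complete sequence, whereas
    every tree has a leaf, so the instance is sent to a single leaf of value [0]
    with threshold [1]. *)
Require Import Defs.
From HB Require Import structures.
From mathcomp Require Import all_boot all_order all_algebra.
From mathcomp Require Import reals.

Set Implicit Arguments.
Unset Strict Implicit.
Unset Printing Implicit Defensive.

Import Order.TTheory GRing.Theory Num.Theory.

Definition full_tree (k n : nat) : rtree :=
  iter n (fun t => Node (nseq k t)) (Node [::]).

Lemma kary_full_tree k n : kary k (full_tree k n).
Proof. by elim: n => //= n IHn; rewrite size_nseq leqnn all_nseq IHn orbT. Qed.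

(** For [k = 0] and [n > 0] the root has no children and is itself a leaf, at depth [0] instead of
    [n]. *)
Lemma is_leaf_full_tree k n p : 0 < k ->
  is_leaf (full_tree k n) p = (size p == n) && all (fun i => i < k) p.
Proof.
case: k => // k _; elim: n p => [|n IHn] [|i p] //; first by case: i.
(* The bound on the head index [i] is moved to the front; what remains is the induction hypothesis
   at [p]. *)
rewrite [RHS]/= eqSS andbCA -IHn /is_leaf [subtree _ _]/=.
by rewrite -[_ :: nseq k _]/(nseq k.+1 _) onth_nseq; case: (i < k.+1).
Qed.

Lemma complete_rcons (V : eqType) (eos : V) s : complete eos (rcons s eos).
Proof. by case: s => [|x s] /=; rewrite ?last_rcons eqxx. Qed.

Lemma completeP (V : eqType) (eos : V) s :
  reflect (exists t, s = rcons t eos) (complete eos s).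
Proof.
apply: (iffP idP) => [|[t ->]]; last exact: complete_rcons.
case: s => // x s /= /eqP <-.
by exists (belast x s); rewrite -lastI.
Qed.

Section Reduction.
Variables (R : realType) (V : finType) (eos : V).

(** The default [eos] is never reached at a leaf address, whose entries are below [#|V|]. *)
Definition decode (l : seq nat) : seq V := [seq nth eos (enum V) i | i <- l].

Definition encode (s : seq V) : seq nat := [seq index x (enum V) | x <- s].

Lemma encodeK : cancel encode decode.
Proof.
move=> s; rewrite /decode /encode -map_comp map_id_in // => x _ /=.
by rewrite nth_index ?mem_enum.
Qed.

Lemma all_encode s : all (fun i => i < #|V|) (encode s).
Proof.
by rewrite all_map; apply/allP => x _ /=; rewrite cardE index_mem mem_enum.
Qed.

Lemma card_token_gt0 : 0 < #|V|.
Proof. by apply/card_gt0P; exists eos. Qed.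

Definition leaf_seq (l : seq nat) : seq V := rcons (decode l) eos.

Local Open Scope ring_scope.

Definition leaf_value (I : tmab R eos) (l : seq nat) : R :=
  if tmab_length I == 0%N then 0 else tmab_utility I (leaf_seq l).

Definition leaf_threshold (I : tmab R eos) : R :=
  if tmab_length I == 0%N then 1 else tmab_threshold I.

Lemma leaf_value_ge0 I l : 0 <= leaf_value I l.
Proof. by rewrite /leaf_value; case: ifP => // _; apply: tmab_utility_ge0. Qed.

Lemma leaf_threshold_ge0 I : 0 <= leaf_threshold I.
Proof.
by rewrite /leaf_threshold; case: ifP => // _; apply: tmab_threshold_ge0.
Qed.

Definition tree_of_tmab (I : tmab R eos) : tree_search R :=
  TreeSearch (kary_full_tree #|V| (tmab_length I).-1)
    (fun l _ => leaf_value_ge0 I l) (leaf_threshold_ge0 I).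

Lemma tree_of_tmab_yes I : tmab_yes I <-> tree_search_yes (tree_of_tmab I).
Proof.
rewrite /tmab_yes /tree_search_yes /= /leaf_value /leaf_threshold.
case: (tmab_length I) => [|n] /=.
  by split=> [[s [+ + _]]|[l _]]; [case: s | rewrite ler10].
split=> [[_ [/completeP[t ->]]]|[l]].
  rewrite size_rcons ltnS => tn Au.
  (* Padding only up to length [n] leaves room for the final EOS that [leaf_seq] appends. *)
  exists (encode (t ++ nseq (n - size t) eos)).
    rewrite is_leaf_full_tree ?card_token_gt0// all_encode andbT.
    by rewrite size_map size_cat size_nseq subnKC.
  (* The final EOS is absorbed into the padding and split off again right after [t], which exhibits
     the sequence as the complete [rcons t eos] followed by EOS tokens. *)
  rewrite /leaf_seq encodeK -cats1 -catA -[[:: eos]]/(nseq 1 eos) -nseqD addn1.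
  by rewrite -cat_rcons tmab_utility_eos ?complete_rcons.
rewrite is_leaf_full_tree ?card_token_gt0// => /andP[/eqP size_l _] Au.
exists (leaf_seq l).
by rewrite complete_rcons size_rcons size_map size_l.
Qed.

End Reduction.

(** The one sequence queried at a leaf [l] is [leaf_seq l]; the case split in value and threshold
    looks at the length alone. *)
Lemma black_box_tree_of_tmab (R : realType) : black_box (@tree_of_tmab R).
Proof.
exists (fun V eos _ _ => @leaf_seq V eos) => V eos I I' eqL eqA.
rewrite /= /leaf_threshold /leaf_value eqL eqA; split=> // l _ /= ->.
by [].
Qed.

Theorem theoremC2 (R : realType) :
  exists f : forall (V : finType) (eos : V), @tmab R V eos -> tree_search R,
    black_box f /\
    (forall (V : finType) (eos : V) (I : @tmab R V eos),
       tmab_yes I <-> tree_search_yes (f V eos I)).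
Proof.
exists (@tree_of_tmab R); split; first exact: black_box_tree_of_tmab.
exact: tree_of_tmab_yes.
Qed.
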